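(* Fix $p\in(0,1)$. Then, as $n\to\infty$, \[ \max_{\sigma\in S_n}\mathcal{E}_{S_n}(\sigma) \le \Big(\frac{1+\sqrt{1-p}}{p}\Big) n + o_p(n), \] where the $o_p(n)$ term depends only on $p$ and $n$.
   Context: $S_n$ is the lattice of permutations of $[n]$ under the right weak order (generated by $\sigma\circ(i\ i{+}1)\lessdot\sigma$ whenever $\sigma(i)>\sigma(i+1)$). For $p\in(0,1]$, the Ungarian Markov chain on $S_n$ moves from $\sigma$ by selecting each descent $i$ of $\sigma$ (an index with $\sigma(i)>\sigma(i+1)$) independently with probability $p$ and moving to the meet of $\sigma$ and all $\sigma\circ(i\ i{+}1)$ for selected $i$; equivalently, all selected descents are reversed, with maximal runs of consecutive selected indices reversed as blocks. $\mathcal{E}_{S_n}(\sigma)$ denotes the expected number of steps for this chain started at $\sigma$ to reach the identity permutation. *)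

(* Defs.v *)
From HB Require Import structures.
From mathcomp Require Import all_boot all_order all_algebra all_fingroup.
From mathcomp Require Import all_classical all_reals all_analysis.

Set Implicit Arguments.
Unset Strict Implicit.
Unset Printing Implicit Defensive.

Import Order.TTheory GRing.Theory Num.Theory.
Local Open Scope ring_scope.

(* The Ungarian Markov chain on S_n (right weak order).  Permutations are
   {perm 'I_n}; positions are 0..n-1; a descent is a position i with
   i+1 < n and s(i) > s(i+1). *)
Section Ungarian.
Variables (R : realType) (n : nat) (p : R).

Definition sel (S : {set 'I_n}) (i : nat) : bool := [exists j in S, val j == i].

Fixpoint down (S : {set 'I_n}) (k : nat) : nat :=
  match k with
  | 0 => 0
  | k'.+1 => if sel S k' then (down S k').+1 else 0
  end.

Fixpoint up (S : {set 'I_n}) (fuel k : nat) : nat :=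
  match fuel with
  | 0 => 0
  | f.+1 => if sel S k then (up S f k.+1).+1 else 0
  end.

(* Position k lies in the block [lo, hi] = [k - down, k + up]; reversing
   every maximal block of consecutive selected indices (a run a..b of
   selected indices reverses positions a..b+1) sends k to lo + hi - k. *)
Definition blockrev (S : {set 'I_n}) (k : nat) : nat :=
  (k + up S n k - down S k)%N.

Definition descents (s : {perm 'I_n}) : {set 'I_n} :=
  [set i : 'I_n | [exists j : 'I_n, (val j == (val i).+1) && (s j < s i)%N]].

Definition step_result (s : {perm 'I_n}) (S : {set 'I_n}) (t : {perm 'I_n}) : bool :=
  [forall k : 'I_n, forall k' : 'I_n, (val k' == blockrev S k) ==> (t k == s k')].

(* one-step transition probability: each descent selected independently
   with probability p *)
Definition trans (s t : {perm 'I_n}) : R :=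
  \sum_(S : {set 'I_n} | S \subset descents s)
     (p ^+ #|S| * (1 - p) ^+ (#|descents s| - #|S|) * (step_result s S t)%:R).

(* survive s0 t s = P(X_t = s and X_0, ..., X_t all differ from the
   identity), for the chain started at X_0 = s0 *)
Fixpoint survive (s0 : {perm 'I_n}) (t : nat) : {perm 'I_n} -> R :=
  match t with
  | 0 => fun s => ((s == s0) && (s0 != 1%g))%:R
  | t'.+1 => fun s => (s != 1%g)%:R * \sum_(r : {perm 'I_n}) survive s0 t' r * trans r s
  end.

(* E_{S_n}(s0) = E[T] = sum_{t >= 0} P(T > t), T the hitting time of the
   identity (value in the extended reals, +oo allowed a priori) *)
Definition expected_steps (s0 : {perm 'I_n}) : \bar R :=
  (\sum_(0 <= t <oo) ((\sum_(s : {perm 'I_n}) survive s0 t s)%:E))%E.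

End Ungarian.

(* Main.v *)
Require Import Defs.
From HB Require Import structures.
From mathcomp Require Import all_boot all_order all_algebra all_fingroup.
From mathcomp Require Import all_classical all_reals all_analysis.
From mathcomp Require Import zify ring lra.
Import Order.TTheory GRing.Theory Num.Theory.
Import numFieldNormedType.Exports.
Local Open Scope ring_scope.

(** Fix a threshold [k] and call an entry large if it is at least [k].  The chain
    started at [s] has reached the identity as soon as, for every [k], all large
    entries are to the right of all others.  Watching only the large entries, one
    step of the chain moves them at least as far as a parallel TASEP in which each
    large entry followed by a small one jumps with probability [p].  The gaps of
    this TASEP form [n - k] queues in tandem with service probability [p].  Feed the
    first queue with Bernoulli arrivals of parameter [1 - sqrt (1 - p)], starting
    from the stationary product law: this only slows the system down, every queue
    stays stationary with mean length 1, and [k] is sorted once the number of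
    arrivals exceeds [k] plus the total queue length, i.e. around time
    [n / (1 - sqrt (1 - p)) = n * (1 + sqrt (1 - p)) / p], whatever [k] is.  A
    Chernoff bound makes the probability of exceeding this time by a constant
    factor exponentially small, so a union bound over [k] suffices. *)

(** * Independent coins *)

Section Coins.
Context {R : realType} {p : R}.
Implicit Types (L : nat) (F G : bitseq -> R).

(** Expectation under [L] independent coins, [true] having probability [p]. Peeling one coin at a
    time makes every later argument a list induction. *)
Fixpoint Ecoin L G : R :=
  if L is L'.+1 then p * Ecoin L' (fun T => G (true :: T))
                     + (1 - p) * Ecoin L' (fun T => G (false :: T))
  else G [::].

Lemma eq_Ecoin L F G : F =1 G -> Ecoin L F = Ecoin L G.
Proof. by elim: L F G => [|L IH] F G FG //=; congr (_ * _ + _ * _); apply: IH. Qed.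

Lemma Ecoin_cst L c : Ecoin L (fun=> c) = c.
Proof. by elim: L => //= L ->; ring. Qed.

Lemma Ecoin_linear L a b F G :
  Ecoin L (fun T => a * F T + b * G T) = a * Ecoin L F + b * Ecoin L G.
Proof. by elim: L F G => //= L IH F G; rewrite !IH; ring. Qed.

(** Coins read at distinct places are again independent, and unread coins integrate out. Increasing
    indices let the induction compare only the first coin with the head of [es]. *)
Lemma Ecoin_map_nth L (es : seq nat) G :
    sorted ltn es -> all (fun e => e < L)%N es ->
  Ecoin L (fun T => G (map (nth false T) es)) = Ecoin (size es) G.
Proof.
elim: L es G => [|L IH] es G; first by case: es.
have shift (es' : seq nat) : all (leq 1) es' -> es' = map S (map predn es').
  by elim: es' => //= -[|x] l IHl //= /IHl <-.
(* When no index is 0, the first coin [b] is never read and all indices shift down by one. *)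
have posIH (es' : seq nat) G' b : all (leq 1) es' -> sorted ltn es' ->
    all (fun e => e < L.+1)%N es' ->
    Ecoin L (fun T => G' (map (nth false (b :: T)) es')) = Ecoin (size es') G'.
  move=> /shift -> sE aE; rewrite !size_map.
  rewrite -[in RHS](size_map predn es').
  rewrite -IH; last first.
  - by move: aE; rewrite all_map.
  - by move: sE; rewrite sorted_map.
  by apply: eq_Ecoin => T; rewrite -map_comp.
case: es => [|[|e] es] sE aE.
- by rewrite /= !Ecoin_cst; ring.
- have pos : all (leq 1) es by move: sE => /= /(order_path_min ltn_trans).
  move: sE aE => /= /path_sorted sE aE.
  by rewrite !(posIH es (fun l => G (_ :: l))).
have pos : all (leq 1) (e.+1 :: es).
  move: sE => /= /(order_path_min ltn_trans); apply: sub_all => y.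
  by apply: leq_ltn_trans.
have E b := posIH (e.+1 :: es) G b pos sE aE.
transitivity (p * Ecoin (size (e.+1 :: es)) G + (1 - p) * Ecoin (size (e.+1 :: es)) G).
  by congr (_ * _ + _ * _); apply: E.
by ring.
Qed.

(** Splitting the subsets by whether they contain the head of [l] reproduces the recursion of
    [Ecoin]. *)
Lemma sum_subset_mask (T : finType) (l : seq T) (f : {set T} -> R) : uniq l ->
  \sum_(S : {set T} | S \subset [set x in l])
     p ^+ #|S| * (1 - p) ^+ (size l - #|S|) * f S
  = Ecoin (size l) (fun bs => f [set x in mask bs l]).
Proof.
elim: l f => [|x l IH] f.
  move=> _ /=; rewrite (big_pred1 finset.set0) ?cards0 ?expr0 ?mulr1 ?mul1r //.
  by move=> S /=; rewrite finset.set_nil finset.subset0.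
move=> /= /andP[xl ul].
have xA : x \notin [set y in l] by rewrite inE.
have cA : #|[set y in l]| = size l by rewrite cardsE; apply/card_uniqP.
have setE (m : seq T) : [set y in x :: m] = x |: [set y in m] by rewrite finset.set_cons.
rewrite (bigID (fun S : {set T} => x \in S)) /=; congr (_ + _).
  rewrite (eq_Ecoin _ _ (fun bs => (fun S => f (x |: S)) [set y in mask bs l])); last first.
    by move=> bs; rewrite setE.
  rewrite -(IH (fun S => f (x |: S))) // mulr_sumr.
  rewrite (reindex_onto (fun S => x |: S) (fun S => S :\ x)) /=; last first.
    by move=> S /andP[_ xS]; rewrite finset.setD1K.
  rewrite (eq_bigl (fun S : {set T} => S \subset [set y in l])).
    apply: eq_bigr => S Sl.
    have xS : x \notin S by apply: contra xA; apply: (fintype.subsetP Sl).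
    by rewrite cardsU1 xS add1n subSS exprS; ring.
  move=> S; rewrite setE finset.setU11 andbT.
  apply/andP/idP => [[/fintype.subsetP sub /eqP eS]|sub].
    have xS : x \notin S by rewrite -eS !inE eqxx.
    apply/fintype.subsetP => y yS; have := sub y; rewrite !inE yS orbT => /(_ isT).
    by case/orP => // /eqP yx; move: xS; rewrite -yx yS.
  split; first exact: finset.setUS.
  have xS : x \notin S by apply: contra xA; apply: (fintype.subsetP sub).
  by rewrite finset.setU1K.
rewrite -(IH f) // mulr_sumr; apply: eq_big.
  move=> S; rewrite setE; apply/andP/idP => [[/fintype.subsetP sub xS]|sub].
    apply/fintype.subsetP => y yS; have := sub y yS; rewrite !inE => /orP[] // /eqP yx.
    by move: xS; rewrite -yx yS.
  split; first by apply: fintype.subset_trans sub _; apply: finset.subsetUr.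
  by apply: contra xA; apply: (fintype.subsetP sub).
move=> S /andP[]; rewrite setE => sub xS.
have sub' : S \subset [set y in l].
  apply/fintype.subsetP => y yS; have := fintype.subsetP sub y yS; rewrite !inE => /orP[] // /eqP yx.
  by move: xS; rewrite -yx yS.
have := subset_leq_card sub'; rewrite cA => cS.
by rewrite subSn // exprS; ring.
Qed.

Lemma sum_subset_Ecoin (n L : nat) (D : {set 'I_n}) (f : {set 'I_n} -> R) :
  (n < L)%N ->
  \sum_(S : {set 'I_n} | S \subset D)
     p ^+ #|S| * (1 - p) ^+ (#|D| - #|S|) * f S
  = Ecoin L (fun T => f [set x in D | nth false T (n - x)]).
Proof.
(* The coin of position [x] has index [n - x], so [D] is listed backwards to make the indices
   increase. *)
move=> nL; set l := rev (enum D).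
have ul : uniq l by rewrite rev_uniq enum_uniq.
have sl : size l = #|D| by rewrite size_rev -cardE.
have Dl : [set x in l] = D.
  by apply/finset.setP => x; rewrite inE mem_rev mem_enum.
have := @sum_subset_mask _ l f ul; rewrite Dl sl => ->.
rewrite -sl -(size_map (fun x : 'I_n => (n - x)%N)) -(Ecoin_map_nth L).
- apply: eq_Ecoin => T; congr f.
  rewrite -map_comp -filter_mask; apply/finset.setP => x.
  by rewrite !inE mem_filter mem_rev mem_enum andbC.
- rewrite sorted_map /l rev_sorted.
  have : sorted ltn (map val (enum 'I_n)) by rewrite val_enum_ord iota_ltn_sorted.
  rewrite sorted_map => so.
  have : sorted (relpre val ltn) (enum D).
    rewrite enumT in so; rewrite /enum_mem; apply: sorted_filter => //.
    by move=> a b c /=; apply: ltn_trans.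
  apply: sub_sorted => a b /= ab.
  by have := ltn_ord b; lia.
- rewrite all_map; apply/allP => x _ /=; lia.
Qed.

Hypotheses (p0 : 0 <= p) (p1 : p <= 1).

Lemma le_Ecoin L F G : (forall T, F T <= G T) -> Ecoin L F <= Ecoin L G.
Proof.
elim: L F G => [|L IH] F G FG //=.
by apply: lerD; apply: ler_wpM2l; rewrite ?subr_ge0 //; apply: IH.
Qed.

Lemma Ecoin_ge0 L F : (forall T, 0 <= F T) -> 0 <= Ecoin L F.
Proof. by move=> F0; rewrite -(Ecoin_cst L 0); apply: le_Ecoin. Qed.

End Coins.
Arguments Ecoin {R} p L G.

(** * Queues in tandem *)

(* Parallel update of a tandem of queues: [dl] is the arrival at the first queue,
   and a served customer joins the next queue. *)
Fixpoint qstep (dl : bool) (qs : seq nat) (cs : bitseq) : seq nat :=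
  match qs, cs with
  | q :: qs', c :: cs' =>
      let dl' := c && (0 < q)%N in (q + dl - dl')%N :: qstep dl' qs' cs'
  | _, _ => [::]
  end.

Lemma size_qstep dl qs cs : size qs = size cs -> size (qstep dl qs cs) = size qs.
Proof. by elim: qs cs dl => [|q qs IH] [|c cs] //= dl [/IH ->]. Qed.

(** Conservation of customers: transfers inside the first [i + 1] queues cancel, leaving the arrival
    and the departure from queue [i]. *)
Lemma sumn_take_qstep dl qs cs i : size qs = size cs -> (i < size qs)%N ->
  (sumn (take i.+1 (qstep dl qs cs)) + (nth false cs i && (0 < nth 0 qs i))
   = sumn (take i.+1 qs) + dl)%N.
Proof.
elim: qs cs dl i => [|q qs IH] [|c cs] //= dl [|i] [sz] /=.
  by move=> _; rewrite !take0 /=; case: c; case: q => //=; case: dl => //=; lia.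
rewrite ltnS => /(IH _ (c && (0 < q)%N) _ sz) /= E.
by rewrite -addnA E; case: c {E}; case: q => //=; case: dl => //=; lia.
Qed.

Section Queues.
Context {R : realType} {s : R}.
Hypotheses (s0 : 0 < s) (s1 : s < 1).

Let p := 1 - s ^+ 2.

(* Stationary law of a queue with arrival probability [1 - s] and service
   probability [p]; its mean is 1. *)
Definition qlaw (q : nat) : R :=
  if q is 0 then s / (1 + s) else (s / (1 + s)) ^+ q / (s * (1 + s)).

Arguments qlaw : simpl never.

(* Truncating the product law at [K] keeps all sums finite; half of its mass is
   enough for the final estimate. *)
Fixpoint Equeue (K m : nat) (F : seq nat -> R) : R :=
  if m is m'.+1 then
    \sum_(q < K) qlaw q * Equeue K m' (fun qs => F (nat_of_ord q :: qs))
  else F [::].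

(** Markov operator of the tandem, with an arrival at the first queue with probability [1 - s] at
    each step. *)
Definition Estep (m : nat) (F : seq nat -> R) (qs : seq nat) : R :=
  (1 - s) * Ecoin p m (fun cs => F (qstep true qs cs))
  + s * Ecoin p m (fun cs => F (qstep false qs cs)).

Lemma qlaw_ge0 q : 0 <= qlaw q.
Proof.
have S0 := s0; have S1 := s1.
have h : 0 <= s / (1 + s) by apply: divr_ge0; lra.
case: q => [|q] //; apply: divr_ge0; first exact: exprn_ge0.
by apply: mulr_ge0; lra.
Qed.

Lemma eq_Equeue K m F G : F =1 G -> Equeue K m F = Equeue K m G.
Proof.
elim: m F G => [|m IH] F G FG //=.
by apply: eq_bigr => q _; congr (_ * _); apply: IH => qs.
Qed.

Lemma Equeue_linear K m a b F G :
  Equeue K m (fun qs => a * F qs + b * G qs) = a * Equeue K m F + b * Equeue K m G.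
Proof.
elim: m F G => [|m IH] F G //=.
by rewrite !mulr_sumr -big_split /=; apply: eq_bigr => q _; rewrite IH; ring.
Qed.

Lemma le_Equeue K m F G : (forall qs, size qs = m -> F qs <= G qs) ->
  Equeue K m F <= Equeue K m G.
Proof.
elim: m F G => [|m IH] F G FG /=; first exact: FG.
apply: ler_sum => q _; apply: ler_wpM2l; first exact: qlaw_ge0.
by apply: IH => qs sz; apply: FG; rewrite /= sz.
Qed.

Lemma Equeue_ge0 K m F : (forall qs, 0 <= F qs) -> 0 <= Equeue K m F.
Proof.
elim: m F => [|m IH] F F0 /=; first exact: F0.
by apply: sumr_ge0 => q _; apply: mulr_ge0; [exact: qlaw_ge0|exact: IH].
Qed.

Lemma Equeue_exp K m c (tau : R) :
  Equeue K m (fun qs => c * tau ^+ sumn qs)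
  = c * (\sum_(q < K) qlaw q * tau ^+ q) ^+ m.
Proof.
elim: m c => [|m IH] c /=; first by rewrite !expr0.
rewrite exprS mulrCA mulr_suml; apply: eq_bigr => q _.
rewrite (eq_Equeue _ _ _ (fun qs => (c * tau ^+ q) * tau ^+ sumn qs)).
  by rewrite IH; ring.
by move=> qs; rewrite exprD mulrA.
Qed.

(** Detailed balance between lengths 0 and 1. A customer arriving at an empty queue cannot be served
    in the same step, so the upward rate from 0 lacks the factor [1 - p] present at positive
    lengths. *)
Lemma qlaw_balance0 : qlaw 0 * (1 - s) = qlaw 1 * s * p.
Proof.
have S0 := s0; have S1 := s1.
by rewrite /qlaw /p; field; apply/andP; split; apply: lt0r_neq0; lra. Qed.

Lemma qlaw_balance q : qlaw q.+1 * (1 - s) * (1 - p) = qlaw q.+2 * s * p.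
Proof.
have S0 := s0; have S1 := s1.
rewrite /qlaw /p !exprS; field; apply/andP; split; apply: lt0r_neq0; lra.
Qed.

Lemma Ecoin_qstep_cons m dl q (F : seq nat -> R) qs :
  Ecoin p m.+1 (fun cs => F (qstep dl (q :: qs) cs))
  = p * Ecoin p m (fun cs => F ((q + dl - (0 < q))%N :: qstep (0 < q)%N qs cs))
    + (1 - p) * Ecoin p m (fun cs => F ((q + dl)%N :: qstep false qs cs)).
Proof. by rewrite /= subn0. Qed.

(* Partial balance: a stationary queue fed by Bernoulli arrivals leaves the pair
   (new length, departure) with the law of the pair (old length, arrival). *)
Lemma queue_balance K (Psi : nat -> bool -> R) : (forall q b, 0 <= Psi q b) ->
  \sum_(q < K.+2) qlaw q *
    ((1 - s) * (p * Psi (q + 1 - (0 < q))%N (0 < q)%N + (1 - p) * Psi (q + 1)%N false)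
     + s * (p * Psi (q + 0 - (0 < q))%N (0 < q)%N + (1 - p) * Psi (q + 0)%N false))
  <= \sum_(q < K.+3) qlaw q * ((1 - s) * Psi q true + s * Psi q false).
Proof.
have S0 := s0; have S1 := s1.
move=> Psi0.
have p0 : 0 <= p by rewrite /p subr_ge0 expr2; nra.
have p1 : 0 <= 1 - p by rewrite /p; have := sqr_ge0 s; lra.
(* Exact form of the balance for the truncated sum; the last summand collects what happens at the
   top level [K.+1]. *)
have -> : forall K, \sum_(q < K.+2) qlaw q *
    ((1 - s) * (p * Psi (q + 1 - (0 < q))%N (0 < q)%N + (1 - p) * Psi (q + 1)%N false)
     + s * (p * Psi (q + 0 - (0 < q))%N (0 < q)%N + (1 - p) * Psi (q + 0)%N false))
  = \sum_(q < K.+1) qlaw q * ((1 - s) * Psi q true + s * Psi q false)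
    + qlaw K.+1 * ((1 - s) * p * Psi K.+1 true + s * Psi K.+1 false
                   + (1 - s) * (1 - p) * Psi K.+2 false).
  elim=> [|{}K IH].
    rewrite !big_ord_recl !big_ord0 /= /bump /= ?addn0 ?add0n ?subn0 ?subnn.
    rewrite ?add1n ?addn1 ?subSS ?subn0 ltnn.
    have := qlaw_balance0.
    set a := qlaw 0; set b := qlaw 1 => ab.
    have -> : b * ((1 - s) * (p * Psi 1%N true + (1 - p) * Psi 2%N false)
       + s * (p * Psi 0%N true + (1 - p) * Psi 1%N false))
      = (b * s * p) * Psi 0%N true - (b * s * p) * Psi 1%N false + b *
       ((1 - s) * (p * Psi 1%N true + (1 - p) * Psi 2%N false) + s * Psi 1%N false).
      by ring.
    by rewrite -ab; ring.
  rewrite big_ord_recr IH [in RHS]big_ord_recr /= ?addn0 ?addn1 ?subSS ?subn0.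
  have := qlaw_balance K; set a := qlaw K.+1; set b := qlaw K.+2 => ab.
  set S := \sum_(_ < _) _.
  have -> : b * ((1 - s) * (p * Psi K.+2 true + (1 - p) * Psi K.+3 false)
     + s * (p * Psi K.+1 true + (1 - p) * Psi K.+2 false))
    = (b * s * p) * Psi K.+1 true - (b * s * p) * Psi K.+2 false + b *
     ((1 - s) * (p * Psi K.+2 true + (1 - p) * Psi K.+3 false) + s * Psi K.+2 false).
    by ring.
  by rewrite -ab; ring.
rewrite [X in _ <= X]big_ord_recr /= [X in _ <= X + _]big_ord_recr /= -[X in _ <= X]addrA lerD2l.
have := qlaw_balance K.
have := qlaw_ge0 K.+1; have := qlaw_ge0 K.+2.
set a := qlaw K.+1; set b := qlaw K.+2 => b0 a0 ab.
have -> : a * ((1 - s) * p * Psi K.+1 true + s * Psi K.+1 false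
    + (1 - s) * (1 - p) * Psi K.+2 false) =
  a * ((1 - s) * Psi K.+1 true + s * Psi K.+1 false)
  - a * ((1 - s) * (1 - p) * Psi K.+1 true) + (a * (1 - s) * (1 - p)) * Psi K.+2 false.
  by ring.
(* By detailed balance the mass leaving upward from [K.+1] equals a downward flow out of [K.+2], so
   the additional term of the longer sum pays for it. *)
rewrite ab -subr_ge0.
have -> : forall x y z, x + y - (x - z + b * s * p * Psi K.+2 false)
  = z + (y - b * s * p * Psi K.+2 false) by move=> x y z; ring.
have s1' : 0 <= 1 - s by lra.
apply: addr_ge0; first by do 3 apply: mulr_ge0 => //.
have -> : b * ((1 - s) * Psi K.+2 true + s * Psi K.+2 false) - b * s * p * Psi K.+2 false
  = b * (1 - s) * Psi K.+2 true + b * s * (1 - p) * Psi K.+2 false by ring.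
by apply: addr_ge0; repeat apply: mulr_ge0 => //; apply: ltW.
Qed.

(** Stationarity of the product law, the truncation growing by one since an arrival may lengthen a
    queue. By [queue_balance] the departure from the first queue is again Bernoulli and independent
    of its new length, so induction applies to the remaining queues. *)
Lemma Equeue_Estep K m (F : seq nat -> R) : (forall qs, 0 <= F qs) ->
  Equeue K.+2 m (Estep m F) <= Equeue K.+3 m F.
Proof.
have S0 := s0; have S1 := s1.
have p0 : 0 <= p by rewrite /p subr_ge0 expr2; nra.
have p1 : p <= 1 by rewrite /p; have := sqr_ge0 s; lra.
elim: m F => [|m IH] F F0; first by rewrite /Estep /=; lra.
pose Psi q dl := Equeue K.+2 m (fun qs => Ecoin p m (fun cs => F (q :: qstep dl qs cs))).
have Psi0 q b : 0 <= Psi q b.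
  by apply: Equeue_ge0 => qs; apply: (Ecoin_ge0 p0 p1).
have -> : Equeue K.+2 m.+1 (Estep m.+1 F) = \sum_(q < K.+2) qlaw q *
    ((1 - s) * (p * Psi (q + 1 - (0 < q))%N (0 < q)%N + (1 - p) * Psi (q + 1)%N false)
     + s * (p * Psi (q + 0 - (0 < q))%N (0 < q)%N + (1 - p) * Psi (q + 0)%N false)).
  apply: eq_bigr => q _; congr (_ * _).
  by rewrite -!Equeue_linear; apply: eq_Equeue => qs; rewrite /Estep !Ecoin_qstep_cons.
apply: le_trans (queue_balance K _ Psi0) _.
apply: ler_sum => q _; apply: ler_wpM2l; first exact: qlaw_ge0.
rewrite /Psi -Equeue_linear.
exact: (IH (fun l => F (nat_of_ord q :: l))).
Qed.

Lemma Estep_ge0 m F qs : (forall qs, 0 <= F qs) -> 0 <= Estep m F qs.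
Proof.
have S0 := s0; have S1 := s1.
have p0 : 0 <= p by rewrite /p subr_ge0 expr2; nra.
have p1 : p <= 1 by rewrite /p; have := sqr_ge0 s; lra.
move=> F0; apply: addr_ge0; apply: mulr_ge0; rewrite ?subr_ge0 ?(ltW s0) ?(ltW s1) //;
  by apply: (Ecoin_ge0 p0 p1).
Qed.

Lemma iter_Estep_ge0 m F t qs : (forall qs, 0 <= F qs) -> 0 <= iter t (Estep m) F qs.
Proof. by move=> F0; elim: t qs => [|t IH] qs //=; apply: Estep_ge0. Qed.

Lemma Equeue_iter_Estep K m F t : (forall qs, 0 <= F qs) ->
  Equeue K.+2 m (iter t (Estep m) F) <= Equeue (K + t).+2 m F.
Proof.
move=> F0; elim: t K => [|t IH] K /=; first by rewrite addn0.
apply: le_trans (Equeue_Estep K m _ _) _; first by move=> qs; apply: iter_Estep_ge0.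
by rewrite addnS -addSn; apply: IH.
Qed.

(** The first term is the generating function of the full law at [1 + x], the second the truncated
    tail. The case [x = 0] gives the mass kept, and [x > 0] an exponential moment. *)
Lemma sum_qlaw_exp K (x : R) : 0 <= x -> s * x < 1 ->
  \sum_(q < K.+1) qlaw q * (1 + x) ^+ q
  = (1 + (1 - s) * x) / (1 - s * x)
    - (s / (1 + s) * (1 + x)) ^+ K.+1 / (s * (1 - s * x)).
Proof.
have S0 := s0; have S1 := s1.
move=> x0 sx; elim: K => [|K IH].
  rewrite big_ord1 /qlaw /= expr0 expr1; field.
  by apply/and3P; split; apply: lt0r_neq0; lra.
rewrite big_ord_recr IH /= /qlaw !exprMn !exprVn !exprS.
field.
by repeat (apply/andP; split); rewrite ?expf_neq0 //; apply: lt0r_neq0; lra.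
Qed.

End Queues.
Arguments qlaw {R} s q.
Arguments Equeue {R} s K m F.
Arguments Estep {R} s m F qs.

Set Implicit Arguments.
Unset Strict Implicit.

(** * One step of the chain *)

Section Blocks.
Context {n : nat} (S : {set 'I_n}).

(** The block consists of the positions [lo..hi], hence of the selected indices [lo..hi-1];
    [lo = hi] is a position that stays fixed. *)
Definition is_block (lo hi : nat) : Prop :=
  [/\ forall i, (lo <= i < hi)%N -> sel S i, ~~ sel S hi
    & forall i, i.+1 = lo -> ~~ sel S i].

Lemma down_block lo hi x : is_block lo hi -> (lo <= x <= hi)%N ->
  Defs.down S x = (x - lo)%N.
Proof.
case=> B1 _ B3; elim: x => [|x IH] /andP[lx xh] /=; first by lia.
have [lx'|lx'] := leqP lo x.
  by rewrite B1 ?IH ?lx' ?(ltnW xh) //; lia.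
by rewrite (negPf (B3 _ _)); lia.
Qed.

Lemma up_block lo hi f x : is_block lo hi -> (lo <= x <= hi)%N ->
  (hi - x <= f)%N -> Defs.up S f x = (hi - x)%N.
Proof.
case=> B1 B2 _; elim: f x => [|f IH] x /andP[lx xh] hf /=; first by lia.
have [xh'|xh'] := ltnP x hi.
  by rewrite B1 ?lx // IH; lia.
have -> : x = hi by lia.
by rewrite (negPf B2) subnn.
Qed.

Lemma blockrev_block lo hi x : is_block lo hi -> (lo <= x <= hi)%N -> (hi < n)%N ->
  blockrev S x = (lo + hi - x)%N.
Proof.
by move=> B xB hn; rewrite /blockrev (down_block B xB) (up_block B xB) //; lia.
Qed.

Lemma exists_block x : (forall i, sel S i -> i.+1 < n)%N -> (x < n)%N ->
  exists lo hi, [/\ is_block lo hi, (lo <= x <= hi)%N & (hi < n)%N].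
Proof.
move=> Sn xn.
have [lo [lx L1 L2]] : exists lo, [/\ (lo <= x)%N,
    forall i, (lo <= i < x)%N -> sel S i & forall i, i.+1 = lo -> ~~ sel S i].
  elim: x xn => [|x IH] xn; first by exists 0%N; split=> // i; lia.
  case: (boolP (sel S x)) => Sx; last first.
    by exists x.+1; split=> // i; [lia|case=> ->].
  have [lo [lx L1 L2]] := IH (ltnW xn).
  exists lo; split=> //; first by lia.
  move=> i /andP[li]; rewrite ltnS leq_eqVlt => /orP[/eqP -> //|ix].
  by apply: L1; rewrite li.
have [hi [xh H1 H2 H3]] : exists hi, [/\ (x <= hi)%N,
    forall i, (x <= i < hi)%N -> sel S i, ~~ sel S hi & (hi < n)%N].
  have [u] := ubnP (n - x); elim: u x xn {lx L1} => // u IH x xn xu.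
  case: (boolP (sel S x)) => Sx; last first.
    by exists x; split=> // i; lia.
  have [|hi [xh H1 H2 H3]] := IH x.+1 (Sn _ Sx); first by lia.
  exists hi; split=> //; first by lia.
  move=> i /andP[]; rewrite leq_eqVlt => /orP[/eqP <- //|xi ih].
  by apply: H1; rewrite xi.
exists lo, hi; split; rewrite ?lx //; split=> // i /andP[li ih].
by have [ix|xi] := ltnP i x; [apply: L1|apply: H1]; lia.
Qed.

End Blocks.

Section Step.
Context {n : nat} {s r : {perm 'I_n}} {S : {set 'I_n}}.
Hypothesis SD : S \subset descents s.

Lemma sel_descent i : sel S i ->
  exists a b : 'I_n, [/\ (a : nat) = i, (b : nat) = i.+1 & (s b < s a)%N].
Proof.
case/existsP => a /andP[aS /eqP <-].
have := fintype.subsetP SD a aS; rewrite inE => /existsP[b /andP[/eqP ba sba]].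
by exists a, b.
Qed.

Lemma sel_lt i : sel S i -> (i.+1 < n)%N.
Proof. by move=> /sel_descent[a [b [_ <- _]]]; apply: ltn_ord. Qed.

Lemma blockrev_lt x : (x < n)%N -> (blockrev S x < n)%N.
Proof.
move=> xn; have [lo [hi [B xB hn]]] := exists_block sel_lt xn.
by rewrite (blockrev_block B xB hn); lia.
Qed.

Definition brev (x : 'I_n) : 'I_n := Ordinal (blockrev_lt (ltn_ord x)).

Lemma brevP (x : 'I_n) : exists lo hi, [/\ is_block S lo hi, (lo <= x <= hi)%N,
  (hi < n)%N & forall y : 'I_n, (lo <= y <= hi)%N -> (brev y : nat) = (lo + hi - y)%N].
Proof.
have [lo [hi [B xB hn]]] := exists_block sel_lt (ltn_ord x).
by exists lo, hi; split=> // y yB; rewrite /= (blockrev_block B yB hn).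
Qed.

Lemma brevK : involutive brev.
Proof.
move=> x; have [lo [hi [B xB hn E]]] := brevP x.
have Ex := E x xB.
by apply/ord_inj; rewrite E ?Ex; lia.
Qed.

Lemma block_decreasing lo hi (x y : 'I_n) : is_block S lo hi ->
  (lo <= x)%N -> (x < y)%N -> (y <= hi)%N -> (s y < s x)%N.
Proof.
move=> [B _ _] lx; have [u] := ubnP (nat_of_ord y); elim: u y => // u IH y yu xy yh.
have /sel_descent[a [b [ea eb sba]]] : sel S y.-1 by apply: B; lia.
have by_ : b = y by apply/ord_inj; rewrite eb; lia.
have [xa|xa] := ltnP x a.
  by rewrite -by_; apply: ltn_trans sba (IH _ _ xa _); lia.
by have -> : x = a; [apply/ord_inj; lia|rewrite -by_].
Qed.

Hypothesis sr : step_result s S r.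

Lemma step_resultE x : r x = s (brev x).
Proof. by have /forallP/(_ x)/forallP/(_ (brev x))/implyP/(_ (eqxx _))/eqP := sr. Qed.

End Step.

(** * Large entries and their domination by the TASEP *)

Section Count.
Context {n : nat} (k : nat).
Implicit Types (s r : {perm 'I_n}).

Definition big_set s (j : nat) := [set x : 'I_n | (x < j)%N && (k <= s x)%N].
Definition nbig s j := #|big_set s j|.

Lemma card_ord_interval (A : {set 'I_n}) (a b : nat) :
  (forall x, x \in A -> (a <= x < b)%N) -> (#|A| <= b - a)%N.
Proof.
move=> Aab; rewrite cardE -(size_map (@nat_of_ord n)) -(size_iota a (b - a)).
apply: uniq_leq_size; first by rewrite map_inj_uniq ?enum_uniq //; apply: ord_inj.
by move=> _ /mapP[x + ->]; rewrite mem_enum mem_iota => /Aab; lia.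
Qed.

Lemma nbig_le_index s j : (nbig s j <= j)%N.
Proof.
rewrite -[X in (_ <= X)%N]subn0; apply: card_ord_interval => x.
by rewrite inE => /andP[].
Qed.

Lemma nbig_total s j : (nbig s j <= n - k)%N.
Proof.
rewrite /nbig -(card_imset _ (@perm_inj _ s)); apply: card_ord_interval => y.
by case/imsetP => x; rewrite inE => /andP[_ kx] ->; rewrite kx ltn_ord.
Qed.

Lemma nbig_mono s i j : (i <= j)%N -> (nbig s i <= nbig s j)%N.
Proof.
move=> ij; apply/subset_leq_card/fintype.subsetP => x.
by rewrite !inE => /andP[xi ->]; rewrite (leq_trans xi ij).
Qed.

Lemma nbigS s (x : 'I_n) : nbig s x.+1 = (nbig s x + (k <= s x))%N.
Proof.
rewrite /nbig; case: leqP => kx /=.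
  have -> : big_set s x.+1 = x |: big_set s x.
    apply/finset.setP => y; rewrite !inE ltnS leq_eqVlt -val_eqE /=.
    by case: eqP => //= /ord_inj ->; rewrite kx.
  by rewrite cardsU1 inE ltnn /= addnC.
rewrite addn0; congr #|pred_of_set _|; apply/finset.setP => y.
rewrite !inE ltnS leq_eqVlt; case: eqP => //= /ord_inj ->.
by rewrite leqNgt kx ltnn.
Qed.

Section OneStep.
Context {s r : {perm 'I_n}} {S : {set 'I_n}}.
Hypotheses (SD : S \subset descents s) (sr : step_result s S r).

Let beta := brev SD.
Let betaK : involutive beta := brevK SD.
(* Injects the positions below [j] receiving a large entry into those that held one:
   if the entry comes from the right of [j], then the one it replaces is larger. *)
Let shadow (j : nat) (x : 'I_n) := if (beta x < j)%N then beta x else x.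

Lemma shadow_inj j : {in big_set r j &, injective (shadow j)}.
Proof.
move=> x y; rewrite !inE => /andP[xj _] /andP[yj _]; rewrite /shadow.
case: ifP => bx; case: ifP => by_ //.
- by move=> /(congr1 beta); rewrite !betaK.
- by move=> E; move: by_; rewrite -E betaK xj.
- by move=> E; move: bx; rewrite E betaK yj.
Qed.

Lemma shadow_sub j : shadow j @: big_set r j \subset big_set s j.
Proof.
apply/fintype.subsetP => _ /imsetP[x + ->]; rewrite !inE (step_resultE SD sr) -/beta.
move=> /andP[xj kx]; rewrite /shadow; case: ifP => bx; first by rewrite bx.
rewrite xj (leq_trans kx) //.
have [lo [hi [B xB hn E]]] := brevP SD x.
have Ex : (beta x : nat) = (lo + hi - x)%N by apply: E.
by apply/ltnW/(block_decreasing SD B); lia.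
Qed.

Lemma nbig_step_le j : (nbig r j <= nbig s j)%N.
Proof. by rewrite /nbig -(card_in_imset (@shadow_inj j)) subset_leq_card ?shadow_sub. Qed.

(* The first entry of the block containing the selected descent is large,
   but is missed by [shadow]. *)
Lemma nbig_step_lt (a b : 'I_n) : a \in S -> (b : nat) = a.+1 -> (k <= s a)%N ->
  (s b < k)%N -> (nbig r a.+1 < nbig s a.+1)%N.
Proof.
move=> aS ba ka kb; have [lo [hi [B aB hn E]]] := brevP SD a.
have ahi : (a < hi)%N.
  rewrite ltn_neqAle; case/andP: aB => _ ->; rewrite andbT.
  apply/negP => /eqP ah; case: B => _ /negP nB _; apply: nB; rewrite -ah.
  by apply/existsP; exists a; rewrite aS eqxx.
have lon : (lo < n)%N by lia.
pose o := Ordinal lon.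
have oB : o \in big_set s a.+1.
  rewrite inE /= ltnS; case/andP: aB => la _; rewrite la.
  move: la; rewrite leq_eqVlt => /orP[/eqP la|la].
    by have -> : o = a by apply/ord_inj.
  by apply: leq_trans ka _; apply/ltnW/(block_decreasing SD B) => //=; lia.
rewrite /nbig -(card_in_imset (@shadow_inj a.+1)).
rewrite (cardsD1 o (big_set s a.+1)) oB add1n ltnS.
apply: subset_leq_card; apply/fintype.subsetP => y yI.
rewrite in_setD1 (fintype.subsetP (shadow_sub _) y yI) andbT.
apply/eqP => yo; case/imsetP: yI => x; rewrite inE (step_resultE SD sr) -/beta.
move=> /andP[xa kx]; rewrite yo /shadow.
have Eo : (beta o : nat) = hi by rewrite [LHS]E /=; lia.
case: ifP => bx ox.
  have : (x : nat) = hi by rewrite -Eo ox betaK.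
  lia.
rewrite -ox in kx.
have : (s (beta o) <= s b)%N.
  have [hb|hb] := leqP hi b.
    by have -> : beta o = b by apply/ord_inj; rewrite Eo; lia.
  by apply/ltnW/(block_decreasing SD B); rewrite ?Eo; lia.
lia.
Qed.

End OneStep.

(* The [i]-th TASEP particle from the right, after [d] arrivals, has
   [y = k + sumn (take i qs) - d] holes on its right (none when the subtraction
   truncates), so it sits at position [n - (i + y)].  The bound on [nbig] says that
   the [i]-th large entry from the right is not to the left of it. *)
Definition dominated s (d : nat) (qs : seq nat) : Prop :=
  forall i, (0 < i <= n - k)%N ->
    (nbig s (n - (i + (k + sumn (take i qs) - d))) <= n - k - i)%N.

(* Coins are indexed by the distance to the right end of the word, so that particles
   still to the left of the word have coins too. *)
Definition coin_index (d : nat) (qs : seq nat) : seq nat :=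
  [seq (i + (k + sumn (take i qs) - d))%N | i <- iota 1 (n - k)].

(** Before any arrival particle [i] sits at or left of position [n - k - i], and a prefix of that
    length holds at most that many large entries. Hence any start and any queue lengths are
    allowed. *)
Lemma dominated0 s qs : dominated s 0 qs.
Proof. by move=> i iP; apply: leq_trans (nbig_le_index _ _) _; lia. Qed.

Lemma dominated_sorted s d qs : size qs = (n - k)%N -> (k <= n)%N ->
  dominated s d qs -> (0 < nbig s k)%N -> (d < k + sumn qs)%N.
Proof.
move=> sz kn D; apply: contraLR; rewrite -!leqNgt => dk.
have [m0|m0] := posnP (n - k).
  by have := nbig_total s k; rewrite m0.
(* With [d] at least [k + sumn qs], the leftmost particle has no hole on its right and sits at
   position [k]. *)
have := D (n - k)%N; rewrite m0 leqnn subnn -{1 2}sz take_size => /(_ isT).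
by have -> : (n - (size qs + (k + sumn qs - d)))%N = k by rewrite sz; lia.
Qed.

Lemma sumn_takeS (qs : seq nat) i : (i < size qs)%N ->
  sumn (take i.+1 qs) = (sumn (take i qs) + nth 0 qs i)%N.
Proof. by move=> h; rewrite (take_nth 0%N) // sumn_rcons. Qed.

(** Particles occupy distinct positions, so they use distinct and thus independent coins. *)
Lemma coin_index_sorted d qs : size qs = (n - k)%N -> sorted ltn (coin_index d qs).
Proof.
move=> sz; rewrite /coin_index; apply/(sortedP 0%N) => i.
rewrite size_map size_iota => im.
rewrite !(nth_map 0%N) ?size_iota ?(ltnW im) // !nth_iota ?(ltnW im) //.
by rewrite add1n -[(1 + i.+1)%N]/i.+2 [sumn (take i.+2 _)]sumn_takeS ?sz //; lia.
Qed.

Lemma sumn_take_le (qs : seq nat) i : (sumn (take i qs) <= sumn qs)%N.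
Proof. by rewrite -[in X in (_ <= X)%N](cat_take_drop i qs) sumn_cat leq_addr. Qed.

Lemma coin_index_lt d qs : (k <= n)%N ->
  all (fun e => e < (n + sumn qs).+1)%N (coin_index d qs).
Proof.
move=> kn; apply/allP => _ /mapP[i + ->]; rewrite mem_iota => iP.
have := sumn_take_le qs i; lia.
Qed.

(* A particle level with the [i]-th large entry and having a hole on its right forces
   that entry to be followed by a small one, i.e. to be a descent. *)
Lemma dominated_step s r d qs (T : bitseq) (dl : bool) :
    size qs = (n - k)%N ->
    step_result s [set x in descents s | nth false T (n - x)] r ->
    dominated s d qs ->
  dominated r (d + dl) (qstep dl qs (map (nth false T) (coin_index d qs))).
Proof.
move=> sz sr D [//|i] /andP[_ im].
set S := [set x in _ | _] in sr; set cs := map _ _.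
have SD : S \subset descents s by apply/fintype.subsetP => x; rewrite inE => /andP[].
have szc : size cs = size qs by rewrite !size_map size_iota sz.
have isz : (i < size qs)%N by rewrite sz.
have := sumn_take_qstep dl qs cs i (esym szc) isz.
have -> : nth false cs i = nth false T (i.+1 + (k + sumn (take i.+1 qs) - d)).
  rewrite (nth_map 0%N) ?size_map ?size_iota //.
  by rewrite (nth_map 0%N) ?size_iota // nth_iota // add1n.
have QS := sumn_takeS isz.
have Di := D i.+1 im.
set Q := sumn (take i.+1 qs) in QS Di *; set Q' := sumn (take i.+1 (qstep _ _ _)).
set q := nth 0%N qs i in QS *; set Q0 := sumn (take i qs) in QS.
set y := (k + Q - d)%N in Di *.
case: (boolP (nth false T (i.+1 + y))) => coin /= EQ; last first.
  have -> : (k + Q' - (d + dl) = y)%N by rewrite /y; lia.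
  exact: leq_trans (nbig_step_le SD sr _) Di.
have [q0|q0] := posnP q.
  have -> : (k + Q' - (d + dl) = y)%N by move: EQ; rewrite q0 /y /=; lia.
  exact: leq_trans (nbig_step_le SD sr _) Di.
have -> : (k + Q' - (d + dl) = y.-1)%N by move: EQ; rewrite q0 /y /=; lia.
have [y0|y0] := posnP y.
  have -> : y.-1 = y by rewrite y0.
  exact: leq_trans (nbig_step_le SD sr _) Di.
(* A particle still to the left of the word reaches at most position 0, where nothing has to be
   shown. *)
have [en|en] := ltnP n (i.+1 + y).
  have -> : (n - (i.+1 + y.-1) = 0)%N by lia.
  exact: leq_trans (nbig_le_index _ _) _.
have Pn : (n - (i.+1 + y) < n)%N by lia.
pose a := Ordinal Pn.
have ea : (n - (i.+1 + y.-1) = a.+1)%N by rewrite /=; lia.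
rewrite ea.
have Pn1 : (n - (i.+1 + y.-1) < n)%N by lia.
pose b := Ordinal Pn1.
have ba : (b : nat) = a.+1 by rewrite -ea.
(* As [q] is positive, the particle ahead is at [b.+1] or further right, and its bound passes to
   [b.+1]; the first particle uses the total number of large entries. *)
have Db : (nbig s b.+1 <= n - k - i)%N.
  have [i0|i0] := posnP i.
    by rewrite i0 subn0; apply: nbig_total.
  have := D i; rewrite i0 -/Q0 => /(_ (ltnW im)); apply: leq_trans.
  by apply: nbig_mono; rewrite /= /y in en *; lia.
have Ea : (nbig s a <= n - k - i.+1)%N by [].
have Sa := nbigS s a; have Sb := nbigS s b; rewrite ba in Sb Db.
have ea' : (a : nat) = (n - (i.+1 + y))%N by [].
clearbody a b.
(* In the bad case the bounds at [a] and [b.+1] force a large entry at [a] and a small one at [b].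
   This descent is selected by the very coin of the particle. *)
have [ok|bad] := leqP (nbig s a.+1) (n - k - i.+1).
  exact: leq_trans (nbig_step_le SD sr _) ok.
have ka : (k <= s a)%N by move: Sa; case: leqP => //= _; lia.
have kb : (s b < k)%N.
  move: Sb; case: leqP => //= _ Sb; move: Db; rewrite Sb; lia.
have aS : a \in S.
  rewrite !inE; apply/andP; split.
    apply/existsP; exists b; apply/andP; split; first exact/eqP.
    exact: leq_trans kb ka.
  by rewrite ea' subKn.
have := nbig_step_lt SD sr aS ba ka kb.
move: Db; rewrite Sb; lia.
Qed.

End Count.

(** * Survival probabilities *)

Section Chain.
Context {R : realType} {n : nat} (p : R).
Hypotheses (p0 : 0 <= p) (p1 : p <= 1).
Implicit Types (s r : {perm 'I_n}) (g : {perm 'I_n} -> R).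

Definition chain_op g s : R := \sum_r trans p s r * g r.

Lemma trans_ge0 s r : 0 <= trans p s r.
Proof.
apply: sumr_ge0 => S _; do !apply: mulr_ge0; rewrite ?ler0n //; apply: exprn_ge0 => //.
by rewrite subr_ge0.
Qed.

Lemma survive_ge0 s0 t s : 0 <= survive p s0 t s.
Proof.
elim: t s => [|t IH] s /=; first exact: ler0n.
by apply: mulr_ge0; rewrite ?ler0n //; apply: sumr_ge0 => r _; apply/mulr_ge0/trans_ge0.
Qed.

Lemma survive1 s0 t : survive p s0 t 1%g = 0.
Proof.
case: t => [|t] /=; last by rewrite eqxx mul0r.
by case: eqVneq => // <-; rewrite eqxx.
Qed.

Lemma chain_op_ge0 g s : (forall s, 0 <= g s) -> 0 <= chain_op g s.
Proof. by move=> g0; apply: sumr_ge0 => r _; apply: mulr_ge0 => //; apply: trans_ge0. Qed.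

Lemma iter_chain_op_ge0 g t s : (forall s, 0 <= g s) -> 0 <= iter t chain_op g s.
Proof. by move=> g0; elim: t s => //= t IH s; apply: chain_op_ge0. Qed.

(** Forgetting the killing at the identity only increases the expectation of a nonnegative
    function. *)
Lemma sum_survive_le s0 t g : (forall s, 0 <= g s) ->
  \sum_s survive p s0 t s * g s <= iter t chain_op g s0.
Proof.
elim: t g => [|t IH] g g0.
  rewrite /= (bigD1 s0) //= big1 ?addr0.
    rewrite eqxx /=; case: (_ != _); rewrite ?mul1r // mul0r; exact: g0.
  by move=> s /negPf ->; rewrite mul0r.
rewrite iterSr; apply: le_trans (IH _ (fun s => chain_op_ge0 s g0)).
rewrite /chain_op; under [X in _ <= X]eq_bigr do rewrite mulr_sumr.
rewrite exchange_big /=; apply: ler_sum => s _.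
under [X in _ <= X]eq_bigr do rewrite mulrA.
rewrite -mulr_suml; apply: ler_wpM2r; first exact: g0.
rewrite ler_piMl ?lern1 //; last by case: (_ != _).
by apply: sumr_ge0 => r _; apply: mulr_ge0; [exact: survive_ge0|exact: trans_ge0].
Qed.

(** The selected set determines the next permutation, so a bound for each coin outcome suffices.
    This is the coupling interface between the chain and the queues. *)
Lemma chain_op_le_Ecoin g s L (H : bitseq -> R) : (n < L)%N ->
    (forall T, 0 <= H T) ->
    (forall T r, step_result s [set x in descents s | nth false T (n - x)] r -> g r <= H T) ->
  chain_op g s <= Ecoin p L H.
Proof.
move=> nL H0 gH.
have -> : chain_op g s = \sum_(S : {set 'I_n} | S \subset descents s)
    p ^+ #|S| * (1 - p) ^+ (#|descents s| - #|S|)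
      * \sum_r (step_result s S r)%:R * g r.
  rewrite /chain_op /trans.
  under eq_bigr do rewrite mulr_suml.
  rewrite exchange_big /=; apply: eq_bigr => S _; rewrite mulr_sumr.
  by apply: eq_bigr => r _; rewrite mulrA.
rewrite (sum_subset_Ecoin n L _ _ nL); apply: le_Ecoin => // T.
set S := [set x in _ | _].
have SD : S \subset descents s by apply/fintype.subsetP => x; rewrite inE => /andP[].
case: (pickP (step_result s S)) => [r sr|no]; last first.
  by rewrite big1 // => r _; rewrite no mul0r.
rewrite (bigD1 r) //= sr mul1r big1 ?addr0; first exact: gH.
move=> r' rr'; case: (boolP (step_result s S r')) => [sr'|_]; last by rewrite mul0r.
case/eqP: rr'; apply/permP => x.
by rewrite (step_resultE SD sr) (step_resultE SD sr').
Qed.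

Lemma iter_chain_op_le1 t s : iter t chain_op (fun=> 1) s <= 1.
Proof.
elim: t s => //= t IH s.
rewrite -[X in _ <= X](Ecoin_cst (p := p) n.+1 1).
by apply: chain_op_le_Ecoin.
Qed.

End Chain.

(** If every threshold is sorted, then [s x <= x] for all [x], and injectivity forces the identity
    by strong induction. *)
Lemma exists_unsorted n (s : {perm 'I_n}) : s != 1%g ->
  exists k : 'I_n.+1, (0 < nbig k s k)%N.
Proof.
move=> s1; apply/existsP; apply: contraNT s1; rewrite negb_exists => /forallP h.
have le x : (s x <= x)%N.
  rewrite -ltnS ltnNge; apply/negP => xs.
  have /negP[] := h (Ordinal (ltn_ord x : x.+1 < n.+1)%N).
  by apply/card_gt0P; exists x; rewrite inE /= ltnSn.
apply/eqP/permP => x; rewrite perm1.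
have [u] := ubnP (nat_of_ord x); elim: u x => // u IH x xu.
apply/ord_inj/eqP; have := le x; rewrite leq_eqVlt => /orP[//|lt].
by have /perm_inj -> := IH (s x) (leq_trans lt xu).
Qed.

Lemma expr_small (R : realType) (r e : R) : 0 <= r -> r < 1 -> 0 < e ->
  exists K0, forall K, (K0 <= K)%N -> r ^+ K <= e.
Proof.
move=> r0 r1 e0.
have : ((fun K => r ^+ K) @ \oo --> (0 : R))%classic by apply: cvg_expr; rewrite ger0_norm.
move=> /cvgr0Pnorm_le /(_ e e0)[K0 _ hK]; exists K0 => K KK.
by have := hK K KK; rewrite /= ger0_norm ?exprn_ge0.
Qed.

(** * Chernoff bound for a single threshold *)

Section Threshold.
Context {R : realType} {sq : R}.
Hypotheses (sq0 : 0 < sq) (sq1 : sq < 1).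
Let p := 1 - sq ^+ 2.

Let p0 : 0 <= p. Proof. have h0 := sq0; have h1 := sq1. by rewrite /p subr_ge0 expr2; nra. Qed.
Let p1 : p <= 1. Proof. by rewrite /p; have := sqr_ge0 sq; lra. Qed.

Definition unsorted n (k : nat) (s : {perm 'I_n}) : R := (0 < nbig k s k)%N%:R.

(* If [k] is unsorted then [d < k + Q], [Q] the total queue length, whence
   [1 <= w tau^Q + w^-1 tau^(k - d)], the product of the summands being at least 1. *)
Lemma unsorted_le n (k : nat) (s : {perm 'I_n}) (tau w : R) t d qs :
    1 <= tau -> 0 < w -> (k <= n)%N -> size qs = (n - k)%N ->
    dominated k s d qs ->
  iter t (chain_op p) (unsorted k) s <=
    w * iter t (Estep sq (n - k)) (fun qs => tau ^+ sumn qs) qs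
    + w^-1 * tau ^+ k * tau ^- d * (sq + (1 - sq) / tau) ^+ t.
Proof.
move=> tau1 w0 kn.
have tau0 : 0 < tau by apply: lt_le_trans tau1.
have [h0 h1] := (ltW sq0, ltW sq1).
have rho0 : 0 <= sq + (1 - sq) / tau.
  by apply: addr_ge0 => //; apply: divr_ge0; rewrite ?subr_ge0 // ltW.
have V0 qs' : 0 <= tau ^+ sumn qs' by apply/exprn_ge0/ltW.
elim: t s d qs => [|t IH] s d qs sz D.
  rewrite /= expr0 mulr1 /unsorted.
  have u0 : 0 < w * tau ^+ sumn qs by rewrite mulr_gt0 ?exprn_gt0.
  have v0 : 0 < w^-1 * tau ^+ k * tau ^- d.
    by rewrite !mulr_gt0 ?invr_gt0 ?exprn_gt0.
  have [uns|_] := ltnP 0 (nbig k s k); last by rewrite /= addr_ge0 // ltW.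
  have dk := dominated_sorted sz kn D uns.
  have uv : 1 <= (w * tau ^+ sumn qs) * (w^-1 * tau ^+ k * tau ^- d).
    have -> : (w * tau ^+ sumn qs) * (w^-1 * tau ^+ k * tau ^- d)
        = (tau ^+ (k + sumn qs)) / tau ^+ d.
      by rewrite exprD; field; rewrite expf_neq0 lt0r_neq0.
    by rewrite -expfB // exprn_ege1.
  move: u0 v0 uv; set u := w * _; set v := w^-1 * _ * _ => u0 v0 uv /=.
  nra.
set m := (n - k)%N.
pose H t d qs := w * iter t (Estep sq m) (fun qs => tau ^+ sumn qs) qs
    + w^-1 * tau ^+ k * tau ^- d * (sq + (1 - sq) / tau) ^+ t.
have H0 t' d' qs' : 0 <= H t' d' qs'.
  apply: addr_ge0.
    by apply: mulr_ge0; [exact: ltW|apply: (iter_Estep_ge0 sq0 sq1)].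
  by rewrite !mulr_ge0 ?invr_ge0 ?exprn_ge0 ?(ltW w0) ?(ltW tau0).
pose cs T := map (nth false T) (coin_index (n := n) k d qs).
rewrite [iter t.+1 _ _ s]/=.
(* Domination holds with or without an arrival, so the two bounds may be averaged with weights
   [1 - sq] and [sq]. *)
apply: (@le_trans _ _ (Ecoin p (n + sumn qs).+1 (fun T =>
   (1 - sq) * H t d.+1 (qstep true qs (cs T)) + sq * H t d (qstep false qs (cs T))))).
  apply: chain_op_le_Ecoin => //.
  - by rewrite ltnS leq_addr.
  - by move=> T; apply: addr_ge0; apply: mulr_ge0 => //; rewrite subr_ge0.
  - move=> T r sr.
    have szc : size qs = size (cs T) by rewrite !size_map size_iota.
    have I1 : iter t (chain_op p) (unsorted k) r <= H t d.+1 (qstep true qs (cs T)).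
      apply: IH; first by rewrite size_qstep.
      by rewrite -addn1; apply: (dominated_step true sz sr D).
    have I2 : iter t (chain_op p) (unsorted k) r <= H t d (qstep false qs (cs T)).
      apply: IH; first by rewrite size_qstep.
      by rewrite -[d]addn0; apply: (dominated_step false sz sr D).
    move: I1 I2; set x := iter _ _ _ _; set y := H _ _ _; set z := H _ _ _ => I1 I2.
    by nra.
rewrite Ecoin_linear.
rewrite (Ecoin_map_nth _ _ (fun cs => H t d.+1 (qstep true qs cs)))
  ?coin_index_sorted ?coin_index_lt //.
rewrite (Ecoin_map_nth _ _ (fun cs => H t d (qstep false qs cs)))
  ?coin_index_sorted ?coin_index_lt //.
rewrite size_map size_iota -/m.
have EH d' dl : Ecoin p m (fun cs => H t d' (qstep dl qs cs))
  = w * Ecoin p m (fun cs => iter t (Estep sq m) (fun qs => tau ^+ sumn qs) (qstep dl qs cs))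
    + w^-1 * tau ^+ k * tau ^- d' * (sq + (1 - sq) / tau) ^+ t.
  set c := w^-1 * _ * _ * _.
  transitivity (Ecoin p m (fun cs => w * iter t (Estep sq m)
      (fun qs => tau ^+ sumn qs) (qstep dl qs cs) + c * 1)).
    by apply: eq_Ecoin => T; rewrite mulr1.
  by rewrite Ecoin_linear Ecoin_cst mulr1.
rewrite !EH /= /Estep -/p !exprS le_eqVlt; apply/orP; left; apply/eqP.
by field; rewrite expf_neq0 !lt0r_neq0.
Qed.

Lemma queue_mass m : exists K, 1 / 2 <= (\sum_(q < K.+2) qlaw sq q) ^+ m.
Proof.
have [h0 h1] := (sq0, sq1).
pose r := sq / (1 + sq).
have r0 : 0 <= r by apply: divr_ge0; lra.
have r1 : r < 1 by rewrite /r ltr_pdivrMr; lra.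
(* Each queue may lose mass [e / sq]; Bernoulli's inequality then keeps the total loss over [m]
   queues below one half. *)
pose e := sq / (2 * m.+1%:R) : R.
have m0 : 0 < (m.+1%:R : R) by rewrite ltr0n.
have e0 : 0 < e by apply: divr_gt0 => //; apply: mulr_gt0.
have [K rK] : exists K, r ^+ K.+2 <= e.
  by have [K hK] := expr_small r0 r1 e0; exists K; apply: hK; lia.
exists K.
have -> : \sum_(q < K.+2) qlaw sq q = 1 - r ^+ K.+2 / sq.
  transitivity (\sum_(q < K.+2) qlaw sq q * (1 + 0) ^+ q).
    by apply: eq_bigr => q _; rewrite addr0 expr1n mulr1.
  by rewrite (sum_qlaw_exp sq0 sq1) ?mulr0 ?addr0 ?subr0 ?mulr1 ?divr1.
set x := _ / sq.
have x0 : 0 <= x by apply: divr_ge0; rewrite ?exprn_ge0 // ltW.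
have xe : x <= 1 / (2 * m.+1%:R).
  rewrite /x ler_pdivrMr //; apply: le_trans rK _; rewrite /e.
  by rewrite le_eqVlt; apply/orP; left; apply/eqP; field; rewrite lt0r_neq0.
have xm : m%:R * x <= 1 / 2.
  apply: (@le_trans _ _ (m.+1%:R * x)).
    by apply: ler_wpM2r => //; rewrite ler_nat.
  rewrite -ler_pdivlMl //; apply: le_trans xe _.
  by rewrite le_eqVlt; apply/orP; left; apply/eqP; field; rewrite lt0r_neq0.
have x1 : x <= 1.
  apply: le_trans xe _; rewrite ler_pdivrMr ?mulr_gt0 //.
  have : (1 : R) <= m.+1%:R by rewrite ler1n.
  lra.
have bern : 1 - m%:R * x <= (1 - x) ^+ m.
  elim: (m) => [|j IH]; first by rewrite expr0 mul0r subr0.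
  have : (1 - x) * (1 - j%:R * x) <= (1 - x) ^+ j.+1.
    by rewrite exprS; apply: ler_wpM2l; rewrite ?subr_ge0.
  apply: le_trans; rewrite -addn1 natrD.
  have : 0 <= (j%:R : R) by exact: ler0n.
  by nra.
by lra.
Qed.

(** [unsorted_le] with [tau = 1 + x] and [d = 0], averaged over the truncated stationary law. Its
    left side does not depend on [qs], so dividing by a mass of at least one half costs the factor
    2. *)
Lemma unsorted_chernoff n (k : nat) (s : {perm 'I_n}) (x w : R) t :
    0 <= x < 1 -> 0 < w -> (k <= n)%N ->
  iter t (chain_op p) (unsorted k) s <=
    2 * (w * (1 - x)^-1 ^+ (n - k)
         + w^-1 * (1 + x) ^+ k * (sq + (1 - sq) / (1 + x)) ^+ t).
Proof.
move=> /andP[x0 x1] w0 kn; have [h0 h1] := (sq0, sq1).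
set m := (n - k)%N; set B := iter t _ _ s.
have B0 : 0 <= B.
  by apply: (iter_chain_op_ge0 p0 p1) => r; rewrite /unsorted ler0n.
have [K massK] := queue_mass m.
set c := w^-1 * _ * _.
have c0 : 0 <= c.
  rewrite /c !mulr_ge0 ?invr_ge0 ?exprn_ge0 ?(ltW w0) //; first by lra.
  by apply: addr_ge0; [lra|apply: divr_ge0; lra].
pose mass : R := (\sum_(q < K.+2) qlaw sq q) ^+ m.
have massE a : Equeue sq K.+2 m (fun=> a) = a * mass.
  rewrite (eq_Equeue _ _ _ (fun qs => a * 1 ^+ sumn qs)).
    rewrite Equeue_exp; congr (_ * _ ^+ _); apply: eq_bigr => q _.
    by rewrite expr1n mulr1.
  by move=> qs; rewrite expr1n mulr1.
have sumle j (y : R) : 0 <= y < 1 -> 0 <= \sum_(q < j.+1) qlaw sq q * (1 + y) ^+ q <= (1 - y)^-1.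
  move=> /andP[y0 y1]; apply/andP; split.
    apply: sumr_ge0 => q _; apply: mulr_ge0; first exact: (qlaw_ge0 sq0 sq1).
    by apply: exprn_ge0; lra.
  have sy : sq * y < 1 by nra.
  rewrite (sum_qlaw_exp sq0 sq1) //.
  apply: (@le_trans _ _ ((1 + (1 - sq) * y) / (1 - sq * y))).
    rewrite lerBlDr lerDl; apply: divr_ge0; last by apply: mulr_ge0; lra.
    by apply: exprn_ge0; apply: mulr_ge0; [apply: divr_ge0|]; lra.
  rewrite ler_pdivrMr; last by lra.
  rewrite ler_pdivlMl; last by lra.
  by nra.
have mass1 : mass <= 1.
  have /andP[a0 a1] := sumle K.+1 0 ltac:(by rewrite lexx ltr01).
  rewrite /mass.
  have -> : \sum_(q < K.+2) qlaw sq q = \sum_(q < K.+2) qlaw sq q * (1 + 0) ^+ q.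
    by apply: eq_bigr => q _; rewrite addr0 expr1n mulr1.
  by apply: exprn_ile1 => //; rewrite subr0 invr1 in a1.
have main : B * mass <= w * (1 - x)^-1 ^+ m + c * mass.
  rewrite -massE -(massE c).
  pose V qs : R := iter t (Estep sq m) (fun qs => (1 + x) ^+ sumn qs) qs.
  apply: (@le_trans _ _ (Equeue sq K.+2 m (fun qs => w * V qs + c * 1))).
    apply: (le_Equeue sq0 sq1) => qs sz.
    have := @unsorted_le n k s (1 + x) w t 0 qs _ w0 kn sz (dominated0 _ _).
    by rewrite expr0 invr1 !mulr1; apply; lra.
  rewrite Equeue_linear massE mulrA mulr1 (massE c) lerD2r.
  apply: ler_wpM2l; first exact: ltW.
  apply: le_trans (Equeue_iter_Estep sq0 sq1 _ _ _ _ _) _.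
    by move=> qs; apply: exprn_ge0; lra.
  rewrite (eq_Equeue _ _ _ (fun qs => 1 * (1 + x) ^+ sumn qs)); last first.
    by move=> qs; rewrite mul1r.
  rewrite Equeue_exp mul1r.
  have /andP[a0 a1] := sumle (K + t).+1 x ltac:(by rewrite x0 x1).
  by apply: lerXn2r => //; rewrite nnegrE // (le_trans a0).
have massge : 1 / 2 <= mass by [].
move: main; set M := w * _ => main.
have Bh : B * (1 / 2) <= B * mass by apply: ler_wpM2l.
have ch : c * mass <= c by apply: ler_piMr.
lra.
Qed.

End Threshold.

(** * Exponential decay in time and the final estimate *)

Definition decay_rate (R : realType) (sq x e : R) : R :=
  (1 - sq) * x / 2 * ((1 + x)^-1 - ((1 - x) * (1 + e))^-1).

(** Per unit of time the arrivals contribute decay [(1 - sq) * x / (1 + x)], while queues and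
    threshold cost at most [(1 - sq) * x / ((1 - x) * (1 + e))]; [decay_rate] is half the
    difference. *)
Lemma unsorted_decay (R : realType) (sq x e : R) n (k : nat) (s : {perm 'I_n}) t :
    0 < sq < 1 -> 0 <= x < 1 -> 0 < e -> (k <= n)%N ->
    (1 + e) * n%:R <= (1 - sq) * t%:R ->
  iter t (chain_op (1 - sq ^+ 2)) (unsorted k) s
    <= 4 * expR (- decay_rate sq x e) ^+ t.
Proof.
move=> /andP[s0 s1] x01 e0 kn nt.
case/andP: (x01) => x0 x1.
set kap := decay_rate sq x e.
set m := (n - k)%N.
(* This weight brings the queue term down to [expR (- (kap * t))] and leaves the arrival term the
   other half of the gap. *)
pose w := expR (- (x / (1 - x) * m%:R + kap * t%:R)).
apply: le_trans (unsorted_chernoff s0 s1 s t x01 (expR_gt0 _ : 0 < w) kn) _.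
rewrite -expRM_natr mulNr.
have A1 : w * (1 - x)^-1 ^+ m <= expR (- (kap * t%:R)).
  have -> : expR (- (kap * t%:R)) = w * expR (x / (1 - x)) ^+ m.
    by rewrite -expRM_natr -expRD; congr expR; ring.
  apply: ler_wpM2l; first exact: expR_ge0.
  apply: lerXn2r; rewrite ?nnegrE ?expR_ge0 ?invr_ge0 ?subr_ge0 ?(ltW x1) //.
  apply: le_trans (expR_ge1Dx _).
  by rewrite le_eqVlt; apply/orP; left; apply/eqP; field; rewrite lt0r_neq0 ?subr_gt0.
have A2 : w^-1 * (1 + x) ^+ k * (sq + (1 - sq) / (1 + x)) ^+ t <= expR (- (kap * t%:R)).
  have B1 : (1 + x) ^+ k <= expR (x * k%:R).
    rewrite expRM_natr; apply: lerXn2r; rewrite ?nnegrE ?expR_ge0 ?expR_ge1Dx //.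
    by lra.
  have B2 : (sq + (1 - sq) / (1 + x)) ^+ t <= expR (- ((1 - sq) * x / (1 + x)) * t%:R).
    rewrite expRM_natr; apply: lerXn2r; rewrite ?nnegrE ?expR_ge0 //.
      by apply: addr_ge0; [exact: ltW|apply: divr_ge0; lra].
    apply: le_trans (expR_ge1Dx _).
    by rewrite le_eqVlt; apply/orP; left; apply/eqP; field; rewrite lt0r_neq0 //; lra.
  have B0 : w^-1 = expR (x / (1 - x) * m%:R + kap * t%:R) by rewrite /w expRN invrK.
  rewrite B0; apply: (@le_trans _ _ (expR (x / (1 - x) * m%:R + kap * t%:R)
     * expR (x * k%:R) * expR (- ((1 - sq) * x / (1 + x)) * t%:R))).
    apply: ler_pM => //.
    - by rewrite mulr_ge0 ?expR_ge0 // exprn_ge0 //; lra.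
    - by rewrite exprn_ge0 // addr_ge0 ?(ltW s0) // divr_ge0; lra.
    - by rewrite ler_wpM2l ?expR_ge0.
  rewrite -!expRD ler_expR.
  pose z := x / (1 - x).
  have z0 : 0 <= z by apply: divr_ge0; lra.
  have xz : x <= z by rewrite /z ler_pdivlMr; nra.
  have mk : n%:R = m%:R + k%:R :> R by rewrite -natrD subnK.
  have C1 : z * m%:R + x * k%:R <= z * n%:R.
    by rewrite mk mulrDr lerD2l; apply: ler_wpM2r => //; apply: ler0n.
  have C2 : z * n%:R <= z * ((1 - sq) * t%:R / (1 + e)).
    by apply: ler_wpM2l => //; rewrite ler_pdivlMr; lra.
  have C3 : z * ((1 - sq) * t%:R / (1 + e)) + kap * t%:R
      + - ((1 - sq) * x / (1 + x)) * t%:R = - (kap * t%:R).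
    rewrite /kap /decay_rate /z; field.
    by rewrite !lt0r_neq0 //; lra.
  rewrite -/z; lra.
rewrite -/m in A1 *; lra.
Qed.

Lemma sum_le_geometric_tail (R : realType) (a : nat -> R) (t0 : nat) (c q : R) :
    0 <= q < 1 -> (forall t, a t <= 1) ->
    (forall t, (t0 <= t)%N -> a t <= c * q ^+ t) -> 0 <= c ->
  forall N, \sum_(t < N) a t <= t0%:R + c * q ^+ t0 / (1 - q).
Proof.
move=> /andP[q0 q1] a1 aq c0 N.
have q1' : 0 < 1 - q by lra.
(* The summands are bounded by 1 before [t0] and geometrically afterwards; [minn] and [maxn] treat
   both ranges in one induction. *)
have H : \sum_(t < N) a t <=
    (minn N t0)%:R + c * (q ^+ t0 - q ^+ maxn N t0) / (1 - q).
  elim: N => [|N IH].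
    by rewrite big_ord0 min0n max0n subrr mulr0 mul0r addr0.
  rewrite big_ord_recr /=.
  have [Nt|Nt] := ltnP N t0.
    move: IH; rewrite (minn_idPl (ltnW Nt)) (minn_idPl Nt).
    rewrite (maxn_idPr (ltnW Nt)) (maxn_idPr Nt) -addn1 natrD.
    by have := a1 N; lra.
  move: IH; rewrite (minn_idPr Nt) (minn_idPr (leqW Nt)).
  rewrite (maxn_idPl Nt) (maxn_idPl (leqW Nt)) => IH.
  apply: le_trans (lerD IH (aq _ Nt)) _.
  rewrite exprS le_eqVlt; apply/orP; left; apply/eqP; field.
  by rewrite lt0r_neq0.
apply: le_trans H _; apply: lerD; first by rewrite ler_nat geq_minr.
apply: ler_wpM2r; first by rewrite invr_ge0 ltW.
by apply: ler_wpM2l => //; rewrite lerBlDr lerDl exprn_ge0.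
Qed.

Lemma sum_survive_le1 (R : realType) (p : R) n (s : {perm 'I_n}) t :
  0 <= p -> p <= 1 -> \sum_r survive p s t r <= 1.
Proof.
move=> p0 p1; apply: le_trans (iter_chain_op_le1 p0 p1 t s).
apply: le_trans (sum_survive_le p0 p1 s t (g := fun=> 1) _) => [|r]; last exact: ler01.
by apply: ler_sum => r _; rewrite mulr1.
Qed.

(** Union bound: a surviving state is not the identity, so some threshold is unsorted. *)
Lemma sum_survive_le_unsorted (R : realType) (p : R) n (s : {perm 'I_n}) t :
    0 <= p -> p <= 1 ->
  \sum_r survive p s t r <= \sum_(k < n.+1) iter t (chain_op p) (unsorted k) s.
Proof.
move=> p0 p1.
apply: (@le_trans _ _ (\sum_(k < n.+1) \sum_r survive p s t r * unsorted k r)); last first.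
  by apply: ler_sum => k _; apply: sum_survive_le => // r; rewrite /unsorted ler0n.
rewrite exchange_big /=; apply: ler_sum => r _.
have [->|r1] := eqVneq r 1%g.
  by rewrite survive1 big1 // => k _; rewrite mul0r.
have [k k0] := exists_unsorted r1.
rewrite (bigD1 k) //= /unsorted k0 mulr1 lerDl.
by apply: sumr_ge0 => j _; rewrite mulr_ge0 ?ler0n ?survive_ge0.
Qed.

Unset Implicit Arguments.

Theorem theorem3p1 (R : realType) (p : R) (hp0 : 0 < p) (hp1 : p < 1) :
  forall eps : R, 0 < eps ->
  exists N : nat, forall n : nat, (N <= n)%N ->
  forall s : {perm 'I_n},
    (expected_steps p s <=
       (((1 + Num.sqrt (1 - p)) / p) * n%:R + eps * n%:R)%:E)%E.
Proof.
move=> eps eps0; set sq := Num.sqrt (1 - p).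
have sq2 : sq ^+ 2 = 1 - p by rewrite sqr_sqrtr // subr_ge0 ltW.
have sq0 : 0 < sq by rewrite sqrtr_gt0 subr_gt0.
have sq1 : sq < 1 by rewrite -(expr_lt1 (n := 2)) ?ltW // sq2; lra.
have pE : p = 1 - sq ^+ 2 by rewrite sq2; ring.
have -> : (1 + sq) / p = (1 - sq)^-1.
  rewrite pE; field.
  by rewrite -pE !lt0r_neq0 //; lra.
(* With this [e], the time [(1 + e) * n / (1 - sq)] exceeds [n / (1 - sq)] by exactly
   [eps / 4 * n]. *)
pose e := eps * (1 - sq) / 4.
have e0 : 0 < e by rewrite !mulr_gt0 ?invr_gt0 //; lra.
(* Small enough for [1 + x < (1 - x) * (1 + e)], which makes the decay rate positive. *)
pose x := e / (2 + 2 * e).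
have x0 : 0 < x by apply: divr_gt0; lra.
have x1 : x < 1 by rewrite /x ltr_pdivrMr; lra.
have kap0 : 0 < decay_rate sq x e.
  rewrite /decay_rate; apply: mulr_gt0; first by rewrite !mulr_gt0 ?invr_gt0 //; lra.
  have a1 : 0 < (1 - x) * (1 + e) by apply: mulr_gt0; lra.
  have a2 : 0 < 1 + x by lra.
  rewrite subr_gt0 ltf_pV2 ?posrE //.
  have xe : x * (2 + 2 * e) = e by rewrite /x divfK // lt0r_neq0 //; lra.
  by nra.
pose q := expR (- decay_rate sq x e).
have q0 : 0 <= q by exact: expR_ge0.
have q1 : q < 1 by rewrite expR_lt1 oppr_lt0.
have q1' : 0 < 1 - q by lra.
have d0 : 0 < eps * (1 - q) / 32 by rewrite !mulr_gt0 ?invr_gt0.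
have [K0 hK] := expr_small q0 q1 d0.
(* The first bound makes the geometric tail at most [(n + 1) * eps / 8]; the second gives
   [4 <= eps * n], absorbing the rounding of [t0]. *)
exists (maxn K0 (Num.truncn (4 / eps)).+1) => n; rewrite geq_max => /andP[K0n en] s.
have n1 : (1 : R) <= n%:R by rewrite ler1n; apply: leq_ltn_trans en.
have epsn : 4 <= eps * n%:R.
  rewrite mulrC -ler_pdivrMr //; apply: ltW; apply: lt_le_trans (truncnS_gt _) _.
  by rewrite ler_nat.
pose y := (1 + e) * n%:R / (1 - sq).
have sq1' : 0 < 1 - sq by lra.
have y0 : 0 <= y by apply: divr_ge0; [apply: mulr_ge0|]; lra.
have /andP[ty yt] := truncn_itv y0.
pose t0 := (Num.truncn y).+1.
have t0n : (n <= t0)%N.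
  rewrite -(ler_nat R); apply: le_trans (ltW yt); rewrite /y ler_pdivlMr //.
  by nra.
have p0 := ltW hp0; have p1 := ltW hp1.
have tail t : (t0 <= t)%N -> \sum_r survive p s t r <= 4 * n.+1%:R * q ^+ t.
  move=> tt; apply: le_trans (sum_survive_le_unsorted s t p0 p1) _.
  have -> : 4 * n.+1%:R * q ^+ t = \sum_(k < n.+1) 4 * q ^+ t.
    by rewrite sumr_const card_ord -[RHS]mulr_natr; ring.
  apply: ler_sum => k _; rewrite {1}pE; apply: unsorted_decay => //.
  - by rewrite sq0.
  - by rewrite x1 ltW.
  - by rewrite -ltnS.
  - rewrite -ler_pdivrMl // mulrC -/y.
    by apply: le_trans (ltW yt) _; rewrite ler_nat.
have bound N : \sum_(t < N) \sum_r survive p s t r <= (1 - sq)^-1 * n%:R + eps * n%:R.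
  have q01 : 0 <= q < 1 by rewrite q0.
  have c0 : 0 <= 4 * n.+1%:R :> R by apply: mulr_ge0 => //; apply: ler0n.
  apply: le_trans (sum_le_geometric_tail q01 (fun t => sum_survive_le1 s t p0 p1) tail c0 N) _.
  have qt : q ^+ t0 / (1 - q) <= eps / 32.
    rewrite ler_pdivrMr // mulrAC; apply: hK; exact: leq_trans K0n t0n.
  have T0 : t0%:R <= y + 1 by rewrite /t0 -addn1 natrD lerD2r.
  have yE : y = (1 - sq)^-1 * n%:R + eps / 4 * n%:R.
    by rewrite /y /e; field; rewrite lt0r_neq0.
  have -> : n.+1%:R = n%:R + 1 :> R by rewrite -addn1 natrD.
  rewrite -mulrA.
  have : 4 * (n%:R + 1) * (q ^+ t0 / (1 - q)) <= 4 * (n%:R + 1) * (eps / 32).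
    by apply: ler_wpM2l => //; lra.
  rewrite yE in T0; nra.
rewrite /expected_steps; apply: lime_le.
  apply: is_cvg_nneseries => t _ _; rewrite lee_fin.
  by apply: sumr_ge0 => r _; apply: survive_ge0.
apply: nearW => N; rewrite sumEFin lee_fin big_mkord.
exact: bound.
Qed.
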